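(* Let $a,b\in\mathbb{R}$ be such that $-1<a<0$, $b>1$ and $\frac{\ln|a|}{\ln b}$ is irrational. Let $n\geq 2$ be an integer and consider the diagonal $n\times n$ matrices $A=\mathrm{diag}(a_1,a_2,\ldots,a_n)$ and $B=\mathrm{diag}(b_1,b_2,\ldots,b_n)$, where $a_1=a$, $b_1=b$, and $a_j,b_j$ are real numbers with $|a_j|>1$ and $|b_j|>1$ for $j=2,\ldots,n$. Then $(A,B)$ is a locally hypercyclic pair on $\mathbb{R}^n$ which is not hypercyclic. In particular, \[\{x\in\mathbb{R}^n : J_{(A,B)}(x)=\mathbb{R}^n\}=\{(x_1,0,\ldots,0)^t\in\mathbb{R}^n : x_1\in\mathbb{R}\}.\]
   Context: Here $\mathbb{N}=\{1,2,3,\ldots\}$ and $u^t$ denotes the transpose of $u$. Let $(T_1,T_2)$ be a pair of commuting real $n\times n$ matrices, regarded as linear operators on $X=\mathbb{R}^n$. The pair is hypercyclic if there exists $x\in X$ such that $\{T_1^{k_1}T_2^{k_2}x : k_1,k_2\in\mathbb{N}\cup\{0\}\}$ is dense in $X$. For $x\in X$, the extended limit set $J_{(T_1,T_2)}(x)$ is the set of all $y\in X$ for which there exist a sequence of vectors $x_m\to x$ in $X$ and sequences of non-negative integers $\{k_m^{(1)}\}_{m\in\mathbb{N}}$, $\{k_m^{(2)}\}_{m\in\mathbb{N}}$ with $k_m^{(1)}+k_m^{(2)}\to+\infty$ such that $T_1^{k_m^{(1)}}T_2^{k_m^{(2)}}x_m\to y$. The pair is locally hypercyclic if there exists $x\in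 X\setminus\{0\}$ with $J_{(T_1,T_2)}(x)=X$. *)

(* Defs.v *)
From HB Require Import structures.
From mathcomp Require Import all_boot all_order all_algebra.
From mathcomp Require Import all_classical all_reals all_analysis.
Import numFieldNormedType.Exports.

Set Implicit Arguments.
Unset Strict Implicit.
Unset Printing Implicit Defensive.

Import Order.TTheory GRing.Theory Num.Theory.
Local Open Scope classical_set_scope.
Local Open Scope ring_scope.

(* Real n x n matrices act on R^n = 'cV[R]_n by left multiplication.  The
   topology on 'cV[R]_n is the entrywise (sup-norm) one, i.e. the usual
   topology of R^n.  Commutation of T1 and T2 is not built into the three
   definitions below; it is stated separately with comm_mx. *)

Definition hypercyclic_pair (R : realType) (n : nat) (T1 T2 : 'M[R]_n) : Prop :=
  exists x : 'cV[R]_n,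
    dense [set y : 'cV[R]_n |
      exists k1 k2 : nat, y = T1 ^+ k1 *m (T2 ^+ k2 *m x)].

Definition extended_limit_set (R : realType) (n : nat) (T1 T2 : 'M[R]_n)
    (x : 'cV[R]_n) : set 'cV[R]_n :=
  [set y : 'cV[R]_n |
    exists (u : nat -> 'cV[R]_n) (k1 k2 : nat -> nat),
      [/\ u m @[m --> \oo] --> x,
          (k1 m + k2 m)%N @[m --> \oo] --> \oo &
          T1 ^+ k1 m *m (T2 ^+ k2 m *m u m) @[m --> \oo] --> y]].

Definition locally_hypercyclic_pair (R : realType) (n : nat)
    (T1 T2 : 'M[R]_n) : Prop :=
  exists x : 'cV[R]_n,
    x != 0 /\ extended_limit_set T1 T2 x = [set: 'cV[R]_n].

(* Main.v *)
Require Import Defs.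
From HB Require Import structures.
From mathcomp Require Import all_boot all_order all_algebra.
From mathcomp Require Import all_classical all_reals all_analysis.
From mathcomp Require Import ring lra.
Import numFieldNormedType.Exports.
Import Order.TTheory GRing.Theory Num.Theory.
Local Open Scope classical_set_scope.
Local Open Scope ring_scope.

Set Implicit Arguments.
Unset Strict Implicit.
Unset Printing Implicit Defensive.

(** The matrices are diagonal, so the coordinates decouple.

    Every coordinate past the first only expands: its modulus never decreases
    along an orbit.  An orbit that starts on the hyperplane where such a coordinate
    vanishes stays there, and any other orbit keeps away from this hyperplane,
    so no orbit is dense.  In the same way, if 0 is an extended limit of x then
    that coordinate of x is 0 ([not_hypercyclic_expanding], [limit_set_full_coord0]).

    Conversely let x = (x_1, 0, ..., 0) and let y be any target.  In an
    expanding coordinate take the perturbation y_j / (a_j^k b_j^l): it is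
    mapped exactly on y_j, and it tends to 0 as k + l grows
    ([cvg_inv_powers]).  This works for every choice of the exponents, which
    therefore may be adapted to the first coordinate, where one needs
    a^k b^l v -> y_1 with v -> x_1.  If x_1 = 0 take v = y_1 / b^l, if y_1 = 0
    use a^k -> 0, and otherwise use that the products a^k b^l are dense in the
    line ([dense_powers], [exists_limit_powers]).

    For the density, even powers of a reduce the claim to a positive base, and
    odd powers reach the negative targets.  After taking logarithms, one has to
    see that the semigroup generated by ln c < 0 and ln b > 0 is dense, which
    is true of any additive semigroup of reals that has elements of both signs
    and no nonzero element together with its opposite ([dense_semigroup]);
    irrationality of the ratio gives the last condition. *)

(** * Dense additive semigroups of the line *)

Lemma semigroup_add_multiples (R : numDomainType) (S : set R)
  (addS : forall x y, S x -> S y -> S (x + y)) (s d : R) (m : nat) :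
  S s -> S d -> S (s + d *+ m).
Proof.
move=> Ss Sd; elim: m => [|m IH]; first by rewrite addr0.
by rewrite mulrSr addrA; exact: addS.
Qed.

(** Otherwise the infima p and q of the positive elements and of the moduli of
    the negative ones are positive.  Take elements x and - y of moduli below
    p + q; their sum x - y is nonzero, and whichever sign it has, it is
    too small: x - y >= p would give x >= p + q, and y - x >= q likewise
    y >= p + q. *)
Lemma semigroup_small_element (R : realType) (S : set R)
  (addS : forall x y, S x -> S y -> S (x + y))
  (nS : forall x, 0 < x -> S x -> ~ S (- x)) (u v : R) :
  0 < u -> S u -> 0 < v -> S (- v) ->
  forall e, 0 < e -> exists d, [/\ S d, 0 < `|d| & `|d| < e].
Proof.
move=> u0 Su v0 Sv e e0; apply: contrapT => noS.
have far x : S x -> 0 < `|x| -> e <= `|x|.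
  by move=> Sx x0; rewrite leNgt; apply/negP => xe; apply: noS; exists x.
pose P := [set x | 0 < x /\ S x]; pose Q := [set x | 0 < x /\ S (- x)].
have infP : has_inf P by split; [exists u | exists 0 => x [/ltW]].
have infQ : has_inf Q by split; [exists v | exists 0 => x [/ltW]].
have p0 : e <= inf P.
  apply: lb_le_inf; first by exists u.
  by move=> x [x0 Sx]; rewrite -(gtr0_norm x0) far ?normr_gt0 ?gt_eqF.
have q0 : e <= inf Q.
  apply: lb_le_inf; first by exists v.
  by move=> x [x0 Sx]; rewrite -(gtr0_norm x0) -normrN far ?normr_gt0
    ?oppr_eq0 ?gt_eqF.
have [x [x0 Sx] xlt] := inf_adherent (lt_le_trans e0 q0) infP.
have [y [y0 Sy] ylt] := inf_adherent (lt_le_trans e0 p0) infQ.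
have [xy|yx|xy] := ltgtP x y.
- have : Q (y - x).
    by split; [rewrite subr_gt0 | rewrite opprB addrC; apply: addS].
  by move/(ge_inf infQ.2); have := ge_inf infP.2 (conj x0 Sx); lra.
- have : P (x - y) by split; [rewrite subr_gt0 | apply: addS].
  by move/(ge_inf infP.2); have := ge_inf infQ.2 (conj y0 Sy); lra.
- by apply: (nS x x0 Sx); rewrite xy.
Qed.

(** Walk left in strides of length v until y is passed, then walk back in
    steps of length d < e, which cannot jump over the e-neighbourhood of y. *)
Lemma semigroup_climb (R : realType) (S : set R)
  (addS : forall x y, S x -> S y -> S (x + y)) (v d e y : R) :
  0 < v -> S (- v) -> 0 < d -> S d -> d < e ->
  exists2 s, S s & `|s - y| < e.
Proof.
move=> v0 Sv d0 Sd de.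
have [n yn] : exists n : nat, - y < v *+ n.
  exists (Num.bound (`|y| / v)); rewrite -mulr_natr mulrC -ltr_pdivrMr //.
  apply: le_lt_trans (archi_boundP _); last by rewrite divr_ge0 // ltW.
  by rewrite ler_pM2r ?invr_gt0 // -normrN ler_norm.
have Ss : S (- v + (- v) *+ n) by exact: semigroup_add_multiples.
move: Ss; set s := _ + _ => Ss.
have sy : s < y by rewrite /s mulNrn; lra.
have h : 0 <= (y - s) / d by rewrite divr_ge0 //; lra.
have := truncn_itv h; set q := Num.truncn _ => /andP[h1 h2].
exists (s + d *+ q); first exact: semigroup_add_multiples.
move: h1 h2; rewrite ler_pdivlMr // ltr_pdivrMr // -natr1 mulrDl mul1r.
rewrite -mulr_natl => h1 h2; rewrite ler0_norm; lra.
Qed.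

(** A small element of either sign suffices: if it is negative, apply
    [semigroup_climb] to the opposite semigroup. *)
Lemma dense_semigroup (R : realType) (S : set R)
  (addS : forall x y, S x -> S y -> S (x + y))
  (nS : forall x, 0 < x -> S x -> ~ S (- x)) (u v : R) :
  0 < u -> S u -> 0 < v -> S (- v) ->
  forall y e, 0 < e -> exists2 s, S s & `|s - y| < e.
Proof.
move=> u0 Su v0 Sv y e e0.
have [d [Sd d0 de]] := semigroup_small_element addS nS u0 Su v0 Sv e0.
have [d_lt0|d_gt0|d_eq0] := ltgtP d 0; last by rewrite d_eq0 normr0 ltxx in d0.
- have [||||||s Ss] :=
    @semigroup_climb R [set x | S (- x)] _ u (- d) e (- y) => //=.
  + by move=> x z Sx Sz; rewrite opprD; exact: addS.
  + by rewrite opprK.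
  + by rewrite oppr_gt0.
  + by rewrite opprK.
  + by rewrite -ltr0_norm.
  + move=> sy; exists (- s) => //.
    have -> : - s - y = - (s - - y) by ring.
    by rewrite normrN.
- rewrite gtr0_norm // in de.
  exact: (semigroup_climb addS y v0 Sv d_gt0 Sd de).
Qed.

(** * Density of products of powers *)

(** [dense_semigroup] on the logarithmic scale.  Large exponents come for free
    by aiming at ln t - N ln b and multiplying by b ^+ N afterwards. *)
Lemma dense_powers_pos (R : realType) (c b t e : R) (N : nat) :
  0 < c < 1 -> 1 < b -> irrational (ln c / ln b) -> 0 < t -> 0 < e ->
  exists k l : nat, (N <= l)%N /\ `|c ^+ k * b ^+ l - t| < e.
Proof.
move=> /andP[c0 c1] b1 irr t0 e0.
have lnb : 0 < ln b by rewrite ln_gt0.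
have lnc : ln c < 0 by apply: ln_lt0; rewrite c0.
have b0 : 0 < b by lra.
pose S := [set x : R | exists k l : nat, x = ln c *+ k + ln b *+ l].
have addS x y : S x -> S y -> S (x + y).
  move=> [k [l ->]] [k' [l' ->]]; exists (k + k')%N, (l + l')%N.
  by rewrite !mulrnDr; ring.
have nS x : 0 < x -> S x -> ~ S (- x).
  move=> x0 [k [l xE]] [k' [l' xE']].
  (* Adding the relations for x and - x gives 0 = K ln c + L ln b, where L > 0
     because x > 0 while ln c < 0. *)
  have l0 : (0 < l)%N.
    rewrite lt0n; apply/negP => /eqP l0; move: x0; rewrite xE l0 addr0 ltNge.
    by rewrite mulrn_wle0 // ltW.
  have rel : ln c * (k + k')%:R + ln b * (l + l')%:R = 0.
    by rewrite !mulr_natr !mulrnDr addrACA -xE -xE' subrr.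
  have L0 : 0 < ln b * (l + l')%:R by rewrite mulr_gt0 // ltr0n addn_gt0 l0.
  have K0 : (k + k')%:R != 0 :> R.
    by apply/eqP => K0; move: rel L0; rewrite K0 mulr0 add0r => ->;
      rewrite ltxx.
  apply: irr; exists (- (l + l')%:R / (k + k')%:R) => //.
  rewrite fmorph_div rmorphN !rmorph_nat; apply/eqP.
  rewrite eqr_div ?(gt_eqF lnb) //; apply/eqP.
  by rewrite mulNr mulrC -[LHS]opprK; lra.
have [d d0 expd] : exists2 d, 0 < d &
    forall z, `|z - ln t| < d -> `|expR z - t| < e.
  have /cvgrPdist_lt /(_ e e0) := @continuous_expR R (ln t).
  rewrite lnK ?posrE //; move=> /nbhs_ballP[d /= d0 H]; exists d => // z zd.
  by rewrite distrC; apply: H; rewrite /ball /= distrC.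
have [|||||s [k [l ->]] sy] := @dense_semigroup R S addS nS (ln b) (- ln c)
   _ _ _ _ (ln t - ln b *+ N) d => //.
- by exists 0%N, 1%N; rewrite add0r.
- by rewrite oppr_gt0.
- by exists 1%N, 0%N; rewrite addr0 opprK.
exists k, (l + N)%N; split; first exact: leq_addl.
have -> : c ^+ k * b ^+ (l + N) = expR (ln c *+ k + ln b *+ l + ln b *+ N).
  by rewrite !expRD -!lnXn // !lnK ?posrE ?exprn_gt0 // exprD mulrA.
by apply: expd; rewrite opprB addrA in sy.
Qed.

(** Even exponents of a handle t > 0; for t < 0 one aims at t / a > 0 and
    spends one more factor a, which shrinks the error as `|a| < 1. *)
Lemma dense_powers (R : realType) (a b t e : R) (N : nat) :
  -1 < a < 0 -> 1 < b -> irrational (ln `|a| / ln b) -> t != 0 -> 0 < e ->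
  exists k l : nat, (N <= l)%N /\ `|a ^+ k * b ^+ l - t| < e.
Proof.
move=> /andP[a1 a0] b1 irr t0 e0.
have a20 : 0 < a ^+ 2 < 1 by apply/andP; split; nra.
have irr2 : irrational (ln (a ^+ 2) / ln b).
  have -> : a ^+ 2 = `|a| ^+ 2 by rewrite ltr0_norm // sqrrN.
  rewrite lnXn ?normr_gt0 ?lt_eqF //.
  move=> [q _ qE]; apply: irr; exists (q / 2) => //.
  rewrite fmorph_div /= qE rmorph_nat -mulr_natr.
  by field; rewrite gt_eqF // ln_gt0.
have [t_lt0|t_gt0|tE] := ltgtP t 0; last by rewrite tE eqxx in t0.
- have ta : 0 < t / a by rewrite nmulr_rgt0 // invr_lt0.
  have [k [l [Nl kl]]] := dense_powers_pos N a20 b1 irr2 ta e0.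
  exists (2 * k).+1, l; split => //.
  have -> : a ^+ (2 * k).+1 * b ^+ l - t = a * ((a ^+ 2) ^+ k * b ^+ l - t / a).
    by rewrite exprS exprM; field; rewrite lt_eqF.
  rewrite normrM; apply: le_lt_trans kl.
  by rewrite ler_piMl // ltr0_norm //; lra.
- have [k [l [Nl kl]]] := dense_powers_pos N a20 b1 irr2 t_gt0 e0.
  by exists (2 * k)%N, l; rewrite exprM.
Qed.

(** * Orbits of diagonal matrices *)

Lemma cvg_matrix_entries (T : topologicalType) (I : Type) (F : set_system I)
  (FF : Filter F) m n (u : I -> 'M[T]_(m, n)) (M : 'M[T]_(m, n)) :
  (forall i j, u x i j @[x --> F] --> M i j) -> u @ F --> M.
Proof.
move=> uM A [P MP sPA].
have : \forall x \near F, forall i j, P i j (u x i j).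
  by do 2![apply: filter_forall => ?]; exact: uM.
by apply: filterS => x Px; exact: sPA.
Qed.

Lemma cvg_entry (K : numFieldType) (I : Type) (F : set_system I) m n
  (u : I -> 'M[K]_(m, n)) (M : 'M[K]_(m, n)) i j :
  u @ F --> M -> u x i j @[x --> F] --> M i j.
Proof. by move=> uM; apply: cvg_comp uM (@coord_continuous K m n i j M). Qed.

Lemma mul_diag_powers (R : pzRingType) n (alpha beta : 'I_n -> R) k l
  (x : 'cV[R]_n) (j : 'I_n) (z : 'I_1) :
  (diag_mx (\row_i alpha i) ^+ k *m (diag_mx (\row_i beta i) ^+ l *m x)) j z =
  alpha j ^+ k * (beta j ^+ l * x j z).
Proof.
have pow (d : 'I_n -> R) p (y : 'cV[R]_n) :
    (diag_mx (\row_i d i) ^+ p *m y) j z = d j ^+ p * y j z.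
  elim: p => [|p IH]; first by rewrite !expr0 mul1mx mul1r.
  by rewrite !exprS -mulmxA mul_diag_mx mxE [(\row_i d i) _ _]mxE IH mulrA.
by rewrite !pow.
Qed.

(** With r > 1 the smaller of `|p| and `|q|, the m-th term has modulus at most
    r ^- m. *)
Lemma cvg_inv_powers (R : realType) (p q : R) (k l : nat -> nat) :
  1 < `|p| -> 1 < `|q| -> (forall m, (m <= k m + l m)%N) ->
  (p ^+ k m * q ^+ l m)^-1 @[m --> \oo] --> 0.
Proof.
move=> p1 q1 mkl; apply: norm_cvg0.
pose r := Num.min `|p| `|q|.
have r1 : 1 < r by rewrite lt_min p1.
have r0 : 0 < r by lra.
apply: (@squeeze_cvgr _ _ _ _ (fun=> 0) (fun m => r^-1 ^+ m)).
- near=> m; rewrite normr_ge0 /= normfV normrM !normrX exprVn lef_pV2 ?posrE.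
  + apply: (@le_trans _ _ (r ^+ (k m + l m))).
      by apply: ler_weXn2l => //; exact: ltW.
    rewrite exprD ler_pM ?exprn_ge0 ?(ltW r0) // lerXn2r ?nnegrE ?(ltW r0) //;
      by rewrite ge_min lexx ?orbT.
  + by rewrite mulr_gt0 // exprn_gt0 //; lra.
  + by rewrite exprn_gt0.
- exact: cvg_cst.
- by apply: cvg_expr; rewrite gtr0_norm ?invr_gt0 // invf_lt1.
Unshelve. all: by end_near. Qed.

(** * Expanding coordinates *)

Section ExpandingCoordinates.
Variables (R : realType) (n : nat) (alpha beta : 'I_n -> R).
Let A := diag_mx (\row_(j < n) alpha j).
Let B := diag_mx (\row_(j < n) beta j).

Lemma norm_coord_expand (j : 'I_n) k l (x : 'cV[R]_n) :
  1 <= `|alpha j| -> 1 <= `|beta j| ->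
  `|x j 0| <= `|(A ^+ k *m (B ^+ l *m x)) j 0|.
Proof.
move=> a1 b1; rewrite mul_diag_powers mulrA !normrM !normrX.
by rewrite ler_peMl // mulr_ege1 // exprn_ege1.
Qed.

(** If the j-th coordinate of x is 0 its orbit misses the points whose j-th
    coordinate is near 1; otherwise it misses those whose j-th coordinate is
    smaller than that of x. *)
Lemma not_hypercyclic_expanding (j : 'I_n) :
  1 <= `|alpha j| -> 1 <= `|beta j| -> ~ hypercyclic_pair A B.
Proof.
move=> a1 b1 [x xdense].
pose tube z r := (fun y : 'cV[R]_n => y j 0) @^-1` ball z r.
have otube z r : open (tube z r).
  by apply: open_comp; [move=> y _; exact: coord_continuous | exact: ball_open].
have [x0|x0] := eqVneq (x j 0) 0.
- have [|y [+ [k [l yE]]]] := xdense (tube 1 1) _ (otube _ _).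
    by exists (const_mx 1); rewrite /tube /= mxE; exact: ballxx.
  by rewrite /tube /= -ball_normE /= yE mul_diag_powers
    x0 !mulr0 subr0 normr1 ltxx.
- have [|y [+ [k [l yE]]]] := xdense (tube 0 `|x j 0|) _ (otube _ _).
    by exists 0; rewrite /tube /= mxE; apply: ballxx; rewrite normr_gt0.
  by rewrite /tube /= -ball_normE /= sub0r normrN yE ltNge norm_coord_expand.
Qed.

(** Apply the hypothesis to the target 0: when the images tend to 0, so do the
    smaller coordinates of the approximating vectors, whose limit is x j 0. *)
Lemma limit_set_full_coord0 (j : 'I_n) (x : 'cV[R]_n) :
  1 <= `|alpha j| -> 1 <= `|beta j| ->
  extended_limit_set A B x = [set: 'cV[R]_n] -> x j 0 = 0.
Proof.
move=> a1 b1 Jx.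
have [u [k [l [ux _ uy]]]] : extended_limit_set A B x 0 by rewrite Jx.
have {}uy := cvg_entry (i := j) (j := 0) uy; rewrite mxE in uy.
have {}ux := cvg_entry (i := j) (j := 0) ux.
apply: (norm_cvg_unique ux).
apply: norm_cvg0; apply: (@squeeze_cvgr _ _ _ _ (fun=> 0));
  last exact/norm_cvg0P/uy.
- by near=> m; rewrite normr_ge0 norm_coord_expand.
- exact: cvg_cst.
Unshelve. all: by end_near. Qed.

End ExpandingCoordinates.

(** * The contracting coordinate *)

(** This is the extended limit set of the first coordinate alone, which is the
    whole line at every point x.  [dense_powers] approximates y / x when x and y
    are nonzero, and then v may be constant.  For x = 0 a constant v would stay
    at 0, so v m is the preimage of y under b ^+ m; for y = 0 the powers of a
    suffice. *)
Lemma exists_limit_powers (R : realType) (a b x y : R) :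
  -1 < a < 0 -> 1 < b -> irrational (ln `|a| / ln b) ->
  exists (k l : nat -> nat) (v : nat -> R),
    [/\ forall m, (m <= k m + l m)%N,
        v m @[m --> \oo] --> x &
        a ^+ k m * (b ^+ l m * v m) @[m --> \oo] --> y].
Proof.
move=> /andP[a1 a0] b1 irr.
have b0 : b != 0 by apply: lt0r_neq0; lra.
have [->|x0] := eqVneq x 0.
  exists (fun=> 0%N), id, (fun m => b ^- m * y); split => //.
    rewrite -(mul0r y); apply: cvgM; last exact: cvg_cst.
    under eq_fun do rewrite -exprVn.
    by apply: cvg_expr; rewrite gtr0_norm ?invr_gt0 ?invf_lt1 //; lra.
  under eq_fun do rewrite expr0 mul1r mulVKf ?expf_neq0 //.
  exact: cvg_cst.
have [->|y0] := eqVneq y 0.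
  exists id, (fun=> 0%N), (fun=> x); split => [m||]; first by rewrite addn0.
    exact: cvg_cst.
  under eq_fun do rewrite expr0 mul1r.
  rewrite -(mul0r x); apply: cvgM; last exact: cvg_cst.
  apply: cvg_expr.
  by rewrite ltr0_norm //; lra.
have H m : exists kl : nat * nat, (m <= kl.2)%N /\
    `|a ^+ kl.1 * b ^+ kl.2 - y / x| < m.+1%:R^-1.
  have [|||k [l kl]] := @dense_powers R a b (y / x) m.+1%:R^-1 m _ b1 irr.
  - by rewrite a1.
  - by rewrite mulf_neq0 ?invr_eq0.
  - by rewrite invr_gt0.
  - by exists (k, l).
have [kl klP] := choice H.
exists (fun m => (kl m).1), (fun m => (kl m).2), (fun=> x); split.
- by move=> m; rewrite (leq_trans (klP m).1) // leq_addl.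
- exact: cvg_cst.
have {}klP : a ^+ (kl m).1 * b ^+ (kl m).2 @[m --> \oo] --> y / x.
  apply/cvgrPdist_lt => e e0; near=> m; rewrite distrC.
  apply: lt_trans (klP m).2 _; near: m.
  exact: (near_infty_natSinv_lt (PosNum e0)).
rewrite -(divfK x0 y); under eq_fun do rewrite mulrA.
by apply: cvgM; last exact: cvg_cst.
Unshelve. all: by end_near. Qed.

(** * Extended limit sets on the first axis *)

(** The exponents are dictated by the first coordinate
    ([exists_limit_powers]); the other coordinates of the approximating vectors
    are the exact preimages of those of y. *)
Lemma limit_set_first_axis (R : realType) (n : nat) (alpha beta : 'I_n -> R)
  (a b x1 : R) :
  -1 < a < 0 -> 1 < b -> irrational (ln `|a| / ln b) ->
  (forall j : 'I_n, nat_of_ord j = 0%N -> alpha j = a) ->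
  (forall j : 'I_n, nat_of_ord j = 0%N -> beta j = b) ->
  (forall j : 'I_n, (0 < nat_of_ord j)%N -> 1 < `|alpha j|) ->
  (forall j : 'I_n, (0 < nat_of_ord j)%N -> 1 < `|beta j|) ->
  extended_limit_set (diag_mx (\row_(j < n) alpha j))
    (diag_mx (\row_(j < n) beta j))
    (\col_(j < n) (if nat_of_ord j == 0%N then x1 else 0)) = [set: 'cV[R]_n].
Proof.
move=> ha hb irr alpha0 beta0 alpha1 beta1; apply/seteqP; split=> // y _.
have [y0 y0E] : exists y0, forall j : 'I_n, nat_of_ord j = 0%N -> y j 0 = y0.
  case: (n) y => [|n'] y; first by exists 0 => -[].
  by exists (y ord0 0) => j j0; congr (y _ _); exact: val_inj.
have [k [l [v [mkl vx vy]]]] := exists_limit_powers x1 y0 ha hb irr.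
pose c m j := alpha j ^+ k m * beta j ^+ l m.
exists (fun m =>
  \col_j if nat_of_ord j == 0%N then v m else (c m j)^-1 * y j 0).
exists k, l; split.
- apply: cvg_matrix_entries => j z; rewrite mxE.
  under eq_fun do rewrite mxE.
  case: (posnP j) => [j0|j0]; first by [].
  rewrite -(mul0r (y j 0)); apply: cvgM; last exact: cvg_cst.
  by apply: cvg_inv_powers => //; [exact: alpha1 | exact: beta1].
- apply/cvgnyPge => N; near=> m; apply: leq_trans (mkl m).
  by near: m; exact: nbhs_infty_ge.
- apply: cvg_matrix_entries => j z; rewrite (ord1 z).
  under eq_fun do rewrite mul_diag_powers mxE.
  case: (posnP j) => [j0|j0]; first by rewrite y0E // alpha0 // beta0.
  under eq_fun => m.
    rewrite mulrA mulVKf; last first.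
      by rewrite mulf_neq0 // expf_neq0 // -normr_gt0 (lt_trans ltr01) //
        (alpha1, beta1).
    over.
  exact: cvg_cst.
Unshelve. all: by end_near. Qed.

Theorem theorem3p2 (R : realType) (a b : R)
  (ha : -1 < a < 0) (hb : 1 < b)
  (hab : irrational (ln `|a| / ln b))
  (n : nat) (hn : (2 <= n)%N)
  (alpha beta : 'I_n -> R)
  (halpha1 : forall j : 'I_n, nat_of_ord j = 0%N -> alpha j = a)
  (hbeta1 : forall j : 'I_n, nat_of_ord j = 0%N -> beta j = b)
  (halpha : forall j : 'I_n, (0 < nat_of_ord j)%N -> 1 < `|alpha j|)
  (hbeta : forall j : 'I_n, (0 < nat_of_ord j)%N -> 1 < `|beta j|) :
  let A : 'M[R]_n := diag_mx (\row_(j < n) alpha j) in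
  let B : 'M[R]_n := diag_mx (\row_(j < n) beta j) in
  [/\ comm_mx A B,
      locally_hypercyclic_pair A B,
      ~ hypercyclic_pair A B &
      [set x : 'cV[R]_n | extended_limit_set A B x = [set: 'cV[R]_n]] =
      [set x : 'cV[R]_n | exists x1 : R,
         x = \col_(j < n) (if nat_of_ord j == 0%N then x1 else 0)]].
Proof.
move=> A B; have n0 : (0 < n)%N by exact: ltnW.
split.
- exact: diag_mxC.
- exists (\col_(j < n) (if nat_of_ord j == 0%N then 1 else 0)); split.
    apply/eqP => /matrixP /(_ (Ordinal n0) 0); rewrite !mxE /=.
    by apply/eqP; exact: oner_neq0.
  exact: limit_set_first_axis ha hb hab halpha1 hbeta1 halpha hbeta.
- apply: (@not_hypercyclic_expanding _ _ _ _ (Ordinal hn)); apply: ltW.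
    exact: halpha.
  exact: hbeta.
- apply/seteqP; split=> [x Jx|_ [x1 ->]]; last first.
    exact: limit_set_first_axis ha hb hab halpha1 hbeta1 halpha hbeta.
  exists (x (Ordinal n0) 0); apply/matrixP => j z; rewrite mxE (ord1 z).
  case: (posnP j) => j0; first by congr (x _ _); apply: val_inj.
  by apply: limit_set_full_coord0 Jx; apply: ltW; [exact: halpha | exact: hbeta].
Qed.
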